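(* For every $\varepsilon>0$, $d\in[0,1]$ and $\ell\in\mathbb{N}$ there is an $n_0$ such that for all $n>n_0$ the following holds. \begin{itemize} \item If $\boldsymbol{w}\in\{0,1\}^n$ is $(d,\varepsilon)$-uniform, then for each $\boldsymbol{u}\in\{0,1\}^\ell$ \[\binom{\boldsymbol{w}}{\boldsymbol{u}}=d^{\|\boldsymbol{u}\|_1}(1-d)^{\ell-\|\boldsymbol{u}\|_1}\binom n\ell\pm 5\varepsilon n^\ell .\] \item Conversely, if $\boldsymbol{w}\in\{0,1\}^n$ is such that for all $\boldsymbol{u}\in\{0,1\}^3$ we have \[\binom{\boldsymbol{w}}{\boldsymbol{u}}=d^{\|\boldsymbol{u}\|_1}(1-d)^{3-\|\boldsymbol{u}\|_1}\binom n3\pm \varepsilon n^3,\] then $\boldsymbol{w}$ is $(d,42\varepsilon^{1/3})$-uniform. \end{itemize}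
   Context: Here $[n]=\{1,\dots,n\}$, and $a=b\pm x$ means $a\in[b-x,b+x]$. A word of length $n$ is $\boldsymbol{w}=(w_1,\dots,w_n)\in\{0,1\}^n$; $\|\boldsymbol{w}\|_1=\sum_{i\in[n]}w_i$ is its number of 1-entries. A word $\boldsymbol{w}\in\{0,1\}^n$ is $(d,\varepsilon)$-uniform if for every interval $I\subseteq[n]$ (set of consecutive integers) we have $\sum_{i\in I}w_i=d|I|\pm\varepsilon n$. For $\boldsymbol{u}=(u_1,\dots,u_\ell)\in\{0,1\}^\ell$, $\binom{\boldsymbol{w}}{\boldsymbol{u}}$ denotes the number of occurrences of $\boldsymbol{u}$ as a (not necessarily contiguous) subsequence of $\boldsymbol{w}$, i.e. the number of index sets $\{i_1<\dots<i_\ell\}\subseteq[n]$ with $w_{i_j}=u_j$ for all $j\in[\ell]$. The symbol $\binom{n}{\ell}$ is the ordinary binomial coefficient. *)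

(* Defs.v *)
From HB Require Import structures.
From mathcomp Require Import all_boot all_order all_algebra.
From mathcomp Require Import all_classical all_reals exp.
Set Implicit Arguments.
Unset Strict Implicit.
Unset Printing Implicit Defensive.
Import Order.TTheory GRing.Theory Num.Theory.
Local Open Scope ring_scope.

(* The letter 1 is true, the letter 0 is false (bool coerces to nat).
   Positions are numbered 0, ..., n-1 instead of 1, ..., n. *)
Definition word (n : nat) := n.-tuple bool.

Definition ones (n : nat) (w : word n) : nat := (\sum_(i < n) tnth w i)%N.

(* The relation a = b +- x. *)
Definition eq_pm (R : realType) (a b x : R) : Prop := a \in `[b - x, b + x].

(* The integers a, ..., b-1 that lie in {0, ..., n-1}. As a and b vary, these
   are all the intervals of positions, the empty one included. *)
Definition pos_interval (n a b : nat) : {set 'I_n} :=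
  [set i : 'I_n | (a <= i < b)%N].

Definition uniform (R : realType) (d eps : R) (n : nat) (w : word n) : Prop :=
  forall a b : nat, let I := pos_interval n a b in
    eq_pm (\sum_(i in I) tnth w i)%N%:R (d * #|I|%:R) (eps * n%:R).

(* An index set {i_1 < ... < i_l} is represented by its increasing
   enumeration (i_1, ..., i_l). *)
Definition occurrences (n l : nat) (w : word n) (u : word l) : nat :=
  #|[set t : l.-tuple 'I_n | sorted ltn [seq val i | i <- t]
      & [forall j, tnth w (tnth t j) == tnth u j]]|.

(* Main.v *)
Require Import Defs.
From mathcomp Require Import all_boot all_order all_algebra.
From mathcomp Require Import all_classical all_reals exp.
From mathcomp Require Import zify ring lra.
Set Implicit Arguments.
Unset Strict Implicit.
Unset Printing Implicit Defensive.
Import Order.TTheory GRing.Theory Num.Theory.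
Local Open Scope ring_scope.

(** Write x_i = w_i - d for the discrepancy of the i-th letter, so that
uniformity says that all sums of x over intervals are at most eps n in absolute
value.

Uniform words have the right pattern counts. Expose the first letter b of the
pattern: the number of occurrences of b :: u from position a on is the sum over
i >= a of [w_i = b] times the number of occurrences of u from i + 1 on.
Replacing that number by its estimate costs what induction allows, and then
replacing [w_i = b] by the frequency of b leaves the sum of +- x_i against the
weights 'C(n - i - 1, l), which decrease in i; by Abel summation it is at most
eps n times the first weight. Each of the l letters thus costs
eps n 'C(n, l - 1) ([pattern_count_approx]), and l 'C(n, l - 1) <= 2 n^(l-1)
([size_mul_bin_le]).

Words with the right counts of triples are uniform. A sum over i < j < k of
products c1 (w_i) c2 (w_j) c3 (w_k) is a linear combination of the counts of the
eight patterns of length 3, so it is within a multiple of eps n^3 of its value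
for a random word ([wsum_of_pattern_counts]). For the product x_j x_k that value
is 0, hence the sum over i < j < k of x_j x_k is at most 2 eps n^3. With
T a = x_a + ... + x_(n-1), this triple sum is half the sum of the T (i+1)^2 up
to the diagonal terms x_j^2, which number at most n^2. So the T (i+1)^2 add up to
at most 5 eps n^3 for large n. As T changes by at most 1 from one position to
the next, a value |T m| >= 2k would force k of these squares to be at least k^2
([cube_le_sum_sqr_suffix]); therefore |T| is of order at most eps^(1/3) n
([suffix_disc_bound]), and every interval is a difference of two suffixes. *)

(** * Discrepancies, letter frequencies and weighted sums *)

Lemma eq_pmP (R : realType) (a b x : R) : eq_pm a b x <-> `|a - b| <= x.
Proof. by rewrite /eq_pm in_itv /= ler_distl. Qed.

Lemma down_ind (n : nat) (P : nat -> Prop) :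
  (forall a, (n <= a)%N -> P a) ->
  (forall a, (a < n)%N -> P a.+1 -> P a) -> forall a, P a.
Proof.
move=> P_end P_step a; have [m] := ubnP (n - a).
elim: m a => // m IH a; rewrite ltnS => le_na_m.
have [/P_end //|lt_an] := leqP n a.
by apply: P_step => //; apply: IH; lia.
Qed.

Definition disc (R : realType) (d : R) (n : nat) (w : word n) (i : nat) : R :=
  (nth false w i)%:R - d.

Definition letter_freq (R : realType) (d : R) (b : bool) : R :=
  if b then d else 1 - d.

Definition indic (R : realType) (b : bool) : bool -> R := fun x => (x == b)%:R.

(** The sum over a <= i_1 < ... < i_l < n of the products c_j (g i_j). Arbitrary
weights instead of indicators of letters make it multilinear in [cs], and the
starting position [a] makes it recursive in the first index. *)
Fixpoint wsum (R : realType) (n : nat) (g : nat -> bool)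
    (cs : seq (bool -> R)) (a : nat) : R :=
  if cs is c :: cs' then \sum_(a <= i < n) c (g i) * wsum n g cs' i.+1 else 1.

(** The lower bound [a] makes the count recursive in the first letter. *)
Definition occurrences_from (n l : nat) (w : word n) (u : word l) (a : nat) :=
  #|[set t : l.-tuple 'I_n |
      [&& all (leq a) [seq val i | i <- t], sorted ltn [seq val i | i <- t]
        & [forall j, tnth w (tnth t j) == tnth u j]]]|.

(** Classify the occurrences by the position [i] of the first letter: since the
enumeration is increasing, what remains is an occurrence beyond [i]. *)
Lemma occurrences_from_cons (n l : nat) (w : word n) (b : bool) (u : word l) a :
  (occurrences_from w [tuple of b :: u] a =
   \sum_(a <= i < n) (nth false w i == b) * occurrences_from w u i.+1)%N.
Proof.
transitivity (\sum_(i < n | (a <= i)%N)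
    (tnth w i == b) * occurrences_from w u i.+1)%N; last first.
  rewrite [RHS](big_nat_widenl _ 0) // big_mkord.
  by apply: eq_bigr => i _; rewrite (tnth_nth false).
rewrite /occurrences_from cardsE -sum1_card.
rewrite (reindex (fun p : 'I_n * l.-tuple 'I_n => [tuple of p.1 :: p.2])) /=;
  last first.
  exists (fun t => (thead t, [tuple of behead t])) => [[i t] _|t _] /=.
    by congr (_, _); apply: val_inj.
  by rewrite -tuple_eta.
transitivity (\sum_(p : 'I_n * l.-tuple 'I_n | (a <= p.1)%N &&
   ((tnth w p.1 == b) && [&& all (leq p.1.+1) [seq val i | i <- p.2],
      sorted ltn [seq val i | i <- p.2]
        & [forall j, tnth w (tnth p.2 j) == tnth u j]])) 1)%N.
  apply: eq_bigl => -[i t] /=; rewrite unfold_in /=.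
  rewrite path_sortedE; last exact: ltn_trans.
  have -> : [forall j, tnth w (tnth [tuple of i :: t] j) ==
        tnth [tuple of b :: u] j] =
     (tnth w i == b) && [forall j, tnth w (tnth t j) == tnth u j].
    apply/forallP/andP => [match_iu|[match_i /forallP match_u] j].
      split; first by have := match_iu ord0; rewrite !tnth0.
      by apply/forallP => j; have := match_iu (lift ord0 j); rewrite !tnthS.
    by have [k ->|->] := unliftP ord0 j; rewrite ?tnthS // !tnth0.
  have [le_ai|] := leqP a i => //=.
  case all_t: (all (ltn i) _); rewrite ?andbF //=.
  have -> : all (leq a) [seq val j | j <- t].
    by apply: sub_all all_t => j /= lt_ij; apply: leq_trans (ltnW lt_ij).
  by case: (tnth w i == b); rewrite ?andbF.
rewrite -(pair_big_dep (fun i : 'I_n => (a <= i)%N) (fun i (t : l.-tuple 'I_n) =>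
   ((tnth w i == b) && [&& all (leq i.+1) [seq val i | i <- t],
      sorted ltn [seq val i | i <- t]
        & [forall j, tnth w (tnth t j) == tnth u j]])) (fun _ _ => 1%N)) /=.
apply: eq_bigr => i _; case: (tnth w i == b); rewrite /= ?mul1n ?mul0n.
  by rewrite cardsE sum1_card.
by rewrite big_pred0.
Qed.

Lemma occurrences_fromE (R : realType) (n l : nat) (w : word n) (u : word l) a :
  (occurrences_from w u a)%:R =
  wsum n (nth false w) [seq indic R b | b <- u] a.
Proof.
elim: l u a => [|l IH] u a.
  rewrite [u]tuple0 /= /occurrences_from cardsE.
  rewrite (eq_card (B := predT)) ?card_tuple //.
  move=> t; rewrite unfold_in /= [t]tuple0 /=; apply/forallP => -[] //.
rewrite [u]tuple_eta occurrences_from_cons /= natr_sum.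
by apply: eq_bigr => i _; rewrite natrM IH.
Qed.

Lemma occurrencesE (R : realType) (n l : nat) (w : word n) (u : word l) :
  (occurrences w u)%:R = wsum n (nth false w) [seq indic R b | b <- u] 0.
Proof.
rewrite -occurrences_fromE /occurrences /occurrences_from; congr (_%:R).
by apply: eq_card => t; rewrite !inE all_predT.
Qed.

(** A right end [b] beyond [n] is cut off to [n], as [pos_interval] does. *)
Lemma interval_disc (R : realType) (d : R) (n : nat) (w : word n) a b :
  (\sum_(i in pos_interval n a b) tnth w i)%N%:R
    - d * #|pos_interval n a b|%:R = \sum_(a <= i < minn b n) disc d w i.
Proof.
rewrite natr_sum -sum1_card natr_sum mulr_sumr -sumrB.
rewrite (big_nat_widenl _ 0) // (big_nat_widen _ _ n) ?geq_minr // big_mkord.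
apply: eq_big => i.
  by rewrite inE /= leq_min ltn_ord andbT.
by rewrite mulr1 (tnth_nth false).
Qed.

Lemma letter_freq_prod (R : realType) (d : R) (l : nat) (u : word l) :
  d ^+ ones u * (1 - d) ^+ (l - ones u) = \prod_(b <- u) letter_freq d b.
Proof.
have onesE : ones u = count id u.
  rewrite /ones -sum1_count big_tuple [RHS]big_mkcond /=.
  by apply: eq_bigr => i _; case: (tnth u i).
have -> : (l - ones u = count negb u)%N.
  by rewrite onesE -[X in (X - _)%N](size_tuple u) -(count_predC id) addKn.
rewrite onesE; elim: (val u) => [|[] s IH] /=; first by rewrite big_nil mulr1.
  by rewrite big_cons -IH exprS mulrA.
by rewrite big_cons -IH exprS /= add0n mulrCA.
Qed.

(** * From uniformity to pattern counts *)

(** The hockey-stick identity, read on suffixes: choose the smallest of the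
[k.+1] positions first. *)
Lemma sum_bin_suffix (n k a : nat) :
  (\sum_(a <= i < n) 'C(n - i.+1, k) = 'C(n - a, k.+1))%N.
Proof.
elim/(down_ind (n := n)): a => [a le_na|a lt_an IH].
  by rewrite big_geq //; have -> : (n - a = 0)%N by lia.
by rewrite big_ltn // IH -[in RHS](subnSK lt_an) binS addnC.
Qed.

(** Abel summation turns the sum into one of partial sums of [y], each at most
[e] in absolute value, against the nonnegative decrements of [c], which telescope. *)
Lemma abel_bound (R : realType) (e : R) (y c : nat -> R) (a b : nat) :
  (a <= b)%N -> (forall i, 0 <= c i) -> (forall i, c i.+1 <= c i) ->
  (forall j, (a <= j <= b)%N -> `|\sum_(a <= i < j) y i| <= e) ->
  `|\sum_(a <= i < b) y i * c i| <= e * c a.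
Proof.
move=> le_ab c_ge0 c_dec y_e.
have abel j : (a <= j <= b)%N ->
    `|\sum_(a <= i < j) y i * c i - (\sum_(a <= i < j) y i) * c j|
      <= e * (c a - c j).
  elim: j => [|j IH] jab.
    have -> : a = 0%N by lia.
    by rewrite !big_geq // mul0r subrr normr0 subrr mulr0.
  have [lt_ja|le_aj] := ltnP j a.
    have -> : a = j.+1 by lia.
    by rewrite !big_geq // mul0r subrr normr0 subrr mulr0.
  have /IH {}IH : (a <= j <= b)%N by lia.
  have := y_e _ jab; rewrite !big_nat_recr //=.
  move: IH; set S := \sum_(_ <= _ < _) (_ * _); set Y := \sum_(_ <= _ < _) _.
  move=> IH Ye.
  (* Only the new partial sum meets the new decrement of c. *)
  have -> : S + y j * c j - (Y + y j) * c j.+1 =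
     (S - Y * c j) + (Y + y j) * (c j - c j.+1) by ring.
  apply: le_trans (ler_normD _ _) _.
  have -> : e * (c a - c j.+1) = e * (c a - c j) + e * (c j - c j.+1) by ring.
  apply: lerD => //; rewrite normrM [X in _ * X]ger0_norm ?subr_ge0 //.
  by rewrite ler_wpM2r ?subr_ge0.
have {abel} := abel b; rewrite le_ab leqnn => /(_ isT).
have := y_e b; rewrite le_ab leqnn => /(_ isT).
set S := \sum_(_ <= _ < _) (_ * _); set Y := \sum_(_ <= _ < _) _ => Ye SY.
rewrite -[S](subrK (Y * c b)); apply: le_trans (ler_normD _ _) _.
have -> : e * c a = e * (c a - c b) + e * c b by ring.
by apply: lerD => //; rewrite normrM [X in _ * X]ger0_norm // ler_wpM2r.
Qed.

Lemma indic_disc (R : realType) (d : R) (n : nat) (w : word n) (b : bool) i :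
  indic R b (nth false w i) - letter_freq d b = (-1) ^+ (~~ b) * disc d w i.
Proof.
by rewrite /indic /letter_freq /disc; case: b; case: nth => /=; ring.
Qed.

Lemma letter_freq_itv (R : realType) (d : R) (b : bool) :
  0 <= d <= 1 -> 0 <= letter_freq d b <= 1.
Proof. by case: b => /=; lra. Qed.

Lemma prod_letter_freq_itv (R : realType) (d : R) (u : seq bool) :
  0 <= d <= 1 -> 0 <= \prod_(b <- u) letter_freq d b <= 1.
Proof.
move=> hd; elim: u => [|b u IH]; first by rewrite big_nil ler01 lexx.
have := letter_freq_itv b hd; rewrite big_cons.
set p := letter_freq d b; set q := \prod_(_ <- _) _ in IH *; move=> ?.
by apply/andP; split; nra.
Qed.

(** The error bound reproduces itself: for a pattern [b :: u], the hockey-stick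
identity sums the errors for the tail to [size u] times e 'C(n - a, size u), and
replacing the first letter by its frequency costs e 'C(n - a, size u) once more. *)
Lemma pattern_count_approx (R : realType) (d e : R) (n : nat) (w : word n)
    (u : seq bool) (a : nat) :
  0 <= d <= 1 ->
  (forall a b, (a <= b <= n)%N -> `|\sum_(a <= i < b) disc d w i| <= e) ->
  (a <= n)%N ->
  `|wsum n (nth false w) [seq indic R b | b <- u] a
     - (\prod_(b <- u) letter_freq d b) * 'C(n - a, size u)%:R|
  <= e * ((size u) * 'C(n - a, (size u).-1))%:R.
Proof.
move=> hd w_e.
elim: u a => [|b u IH] a le_an /=.
  by rewrite big_nil bin0 mulr1 subrr normr0 mul0n mulr0.
set f := nth false w; set N := fun i => wsum n f [seq indic R b | b <- u] i.
set q := \prod_(b <- u) letter_freq d b in IH *.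
have e_ge0 : 0 <= e by apply: le_trans (w_e n n _); rewrite ?normr_ge0 ?leqnn.
(* Replace the count of the tail by its estimate, then the indicator of the first
   letter by its frequency. *)
have -> : \sum_(a <= i < n) indic R b (f i) * N i.+1
     - (\prod_(b0 <- b :: u) letter_freq d b0) * 'C(n - a, (size u).+1)%:R =
   \sum_(a <= i < n) indic R b (f i) * (N i.+1 - q * 'C(n - i.+1, size u)%:R)
   + q * (-1) ^+ (~~ b) * \sum_(a <= i < n) disc d w i * 'C(n - i.+1, size u)%:R.
  rewrite -sum_bin_suffix big_cons -/q natr_sum !mulr_sumr -big_split -sumrB /=.
  apply: eq_bigr => i _; rewrite -/f.
  have /eqP := indic_disc d w b i; rewrite subr_eq => /eqP ->.
  by ring.
have -> : e * ((size u).+1 * 'C(n - a, size u))%:R =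
   \sum_(a <= i < n) e * (size u * 'C(n - i.+1, (size u).-1))%:R
   + e * 'C(n - a, size u)%:R.
  rewrite -mulr_sumr -natr_sum -big_distrr /= sum_bin_suffix.
  case: (size u) => [|k] /=; first by rewrite !mul0n mulr0 add0r mul1n.
  by rewrite -mulrDr -natrD [in RHS]addnC -mulSn.
apply: le_trans (ler_normD _ _) _; apply: lerD.
  apply: le_trans (ler_norm_sum _ _ _) _; rewrite big_nat [X in _ <= X]big_nat.
  apply: ler_sum => i /andP[_ lt_in]; rewrite normrM.
  apply: le_trans (IH _ lt_in); rewrite ler_piMl // /indic.
  by case: eqP; rewrite ?normr1 ?normr0 // ler01.
rewrite normrM normrM normrX normrN1 expr1n mulr1.
have /andP[q_ge0 q_le1] := prod_letter_freq_itv u hd.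
rewrite -/q ger0_norm //.
apply: le_trans (ler_piMl _ q_le1) _ => //.
apply: (@le_trans _ _ (e * 'C(n - a.+1, size u)%:R)).
  apply: (@abel_bound R e (disc d w) (fun i => 'C(n - i.+1, size u)%:R)) => //.
    by move=> i; rewrite ler_nat leq_bin2l //; lia.
  by move=> j jan; apply: w_e.
by rewrite ler_wpM2l // ler_nat leq_bin2l //; lia.
Qed.

(** The point is a bound uniform in [l]: k.+1 <= 2 k!, and k! 'C(n, k) is a
falling factorial, hence at most n^k. *)
Lemma size_mul_bin_le (n l : nat) : (n * (l * 'C(n, l.-1)) <= 2 * n ^ l)%N.
Proof.
case: l => [|k] /=; first by rewrite mul0n muln0.
have fact_ge : (k.+1 <= 2 * k`!)%N.
  case: k => // k; rewrite factS.
  by have := fact_gt0 k; nia.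
rewrite expnS [leqRHS]mulnCA leq_mul2l; apply/orP; right.
apply: leq_trans (leq_mul fact_ge (leqnn _)) _.
rewrite -mulnA [(k`! * _)%N]mulnC bin_ffact leq_mul2l /=.
by elim: k {fact_ge} => // k IH; rewrite ffactnSr expnSr leq_mul // leq_subr.
Qed.

(** * From counts of triples to uniformity *)

(** A function of a letter is the combination of the two indicators with its
values as coefficients, and [wsum] is linear in each weight. *)
Lemma wsum_letter_expand (R : realType) (n : nat) (g : nat -> bool)
    (pre post : seq (bool -> R)) (c : bool -> R) (a : nat) :
  wsum n g (pre ++ c :: post) a =
  c true * wsum n g (pre ++ indic R true :: post) a +
  c false * wsum n g (pre ++ indic R false :: post) a.
Proof.
elim: pre a => [|c0 pre IH] a /=; rewrite !mulr_sumr -big_split /=.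
  by apply: eq_bigr => i _; rewrite /indic; case: (g i) => /=; ring.
by apply: eq_bigr => i _; rewrite IH; ring.
Qed.

(** In other words, pattern counts determine all weighted sums. The main term is
the one of independent letters with weights [p], because the mean of a product is
then the product of the means. The weights are expanded into indicators from left
to right; [pre] collects those already expanded. *)
Lemma wsum_of_pattern_counts (R : realType) (n : nat) (g : nat -> bool)
    (p : bool -> R) (E M : R) (cs pre : seq (bool -> R)) :
  (forall u : seq bool, size u = size cs ->
     `|wsum n g (pre ++ [seq indic R b | b <- u]) 0 - M * \prod_(b <- u) p b|
        <= E) ->
  `|wsum n g (pre ++ cs) 0
      - M * \prod_(c <- cs) (c true * p true + c false * p false)|
    <= E * \prod_(c <- cs) (`|c true| + `|c false|).
Proof.
elim: cs pre M => [|c cs IH] pre M count_E.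
  by have := count_E [::] erefl; rewrite !big_nil !mulr1.
have step b : `|wsum n g (pre ++ indic R b :: cs) 0
      - M * p b * \prod_(c <- cs) (c true * p true + c false * p false)|
    <= E * \prod_(c <- cs) (`|c true| + `|c false|).
  rewrite -cat_rcons; apply: IH => u size_u.
  have := count_E (b :: u); rewrite /= size_u => /(_ erefl).
  by rewrite big_cons mulrA cat_rcons.
rewrite wsum_letter_expand !big_cons.
move: (step true) (step false).
set X1 := wsum _ _ _ _; set X0 := wsum _ _ _ _.
set P := \prod_(_ <- _) _; set Q := \prod_(_ <- _) _ => H1 H0.
have -> : c true * X1 + c false * X0
      - M * ((c true * p true + c false * p false) * P) =
    c true * (X1 - M * p true * P) + c false * (X0 - M * p false * P) by ring.
apply: le_trans (ler_normD _ _) _; rewrite !normrM.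
rewrite [X in _ <= X](_ : _ = `|c true| * (E * Q) + `|c false| * (E * Q));
  last by ring.
by apply: lerD; rewrite ler_wpM2l.
Qed.

(** The off-diagonal part is the sum over pairs that counts of triples control;
the diagonal part is of lower order. *)
Lemma sqr_suffix_sum (R : realType) (n : nat) (x : nat -> R) (a : nat) :
  (\sum_(a <= i < n) x i) ^+ 2 =
  2 * (\sum_(a <= i < n) x i * \sum_(i.+1 <= j < n) x j)
    + \sum_(a <= i < n) x i ^+ 2.
Proof.
elim/(down_ind (n := n)): a => [a le_na|a lt_an IH].
  by rewrite !big_geq // expr2 !mulr0 addr0.
rewrite [in LHS]big_ltn // sqrrD IH.
rewrite [X in _ = 2 * X + _]big_ltn // [X in _ = _ + X]big_ltn //.
by ring.
Qed.

(** Suffix sums starting at consecutive positions differ by at most 1, so the [k]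
of them that start just after [m] are still at least [k] in absolute value. There
is room for them because the hypothesis makes the suffix from [m] have length at
least [2 * k]. *)
Lemma cube_le_sum_sqr_suffix (R : realType) (n : nat) (x : nat -> R)
    (m k : nat) :
  (forall i, `|x i| <= 1) ->
  (2 * k)%:R <= `|\sum_(m <= j < n) x j| ->
  (k ^ 3)%:R <= \sum_(0 <= i < n) (\sum_(i.+1 <= j < n) x j) ^+ 2.
Proof.
move=> x_le1 k_le.
have sum_le a b : `|\sum_(a <= j < b) x j| <= (b - a)%:R.
  apply: le_trans (ler_norm_sum _ _ _) _.
  by apply: le_trans (ler_sum _ (fun i _ => x_le1 i)) _; rewrite sumr_const_nat.
have le_kn : (2 * k <= n - m)%N.
  by rewrite -(ler_nat R); apply: le_trans k_le (sum_le _ _).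
have [->|k_gt0] := posnP k; first by rewrite sumr_ge0 // => i _; rewrite sqr_ge0.
rewrite (big_cat_nat (n := m)) //=; last by lia.
rewrite [X in _ + X](big_cat_nat (n := m + k)) //=; [|by lia|by lia].
have sqr_sum_ge0 a b : 0 <= \sum_(a <= i < b) (\sum_(i.+1 <= j < n) x j) ^+ 2.
  by apply: sumr_ge0 => i _; rewrite sqr_ge0.
suff : (k ^ 3)%:R <= \sum_(m <= i < m + k) (\sum_(i.+1 <= j < n) x j) ^+ 2.
  by have := sqr_sum_ge0 0%N m; have := sqr_sum_ge0 (m + k)%N n; lra.
rewrite (_ : (k ^ 3)%:R = \sum_(m <= i < m + k) (k%:R : R) ^+ 2); last first.
  by rewrite sumr_const_nat addKn natrX exprSr mulr_natr.
rewrite big_nat [X in _ <= X]big_nat; apply: ler_sum => i /andP[le_mi lt_i].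
rewrite -[X in _ <= X]real_normK ?num_real // ler_pXn2r ?nnegrE //.
move: k_le; rewrite (big_cat_nat (n := i.+1)) //=; [|by lia|by lia].
move=> /le_trans /(_ (ler_normD _ _)).
have := sum_le m i.+1; have : ((i.+1 - m)%:R : R) <= k%:R by rewrite ler_nat; lia.
by rewrite natrM; lra.
Qed.

(** Here [c] stands for the cube root of the error in the hypothesis on triples. *)
Lemma suffix_disc_bound (R : realType) (d c : R) (n : nat) (w : word n)
    (m : nat) :
  0 <= d <= 1 -> 1 <= c * n%:R -> 1 <= c ^+ 3 * n%:R ->
  (forall u : word 3, `|(occurrences w u)%:R
      - d ^+ ones u * (1 - d) ^+ (3 - ones u) * 'C(n, 3)%:R|
        <= c ^+ 3 * n%:R ^+ 3) ->
  `|\sum_(m <= i < n) disc d w i| <= 21 * c * n%:R.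
Proof.
move=> hd cn_ge1 c3n_ge1 counts.
set x := disc d w.
have x_le1 i : `|x i| <= 1.
  by rewrite ler_norml /x /disc; case: nth => /=; lra.
set T := fun a => \sum_(a <= i < n) x i.
(* The first letter of a triple carries weight 1: it only counts the starting
   positions of the suffixes whose pair sums are added up. *)
have pairs : `|\sum_(0 <= i < n) \sum_(i.+1 <= j < n) x j * T j.+1|
    <= 2 * (c ^+ 3 * n%:R ^+ 3).
  have counts_seq (u : seq bool) : size u = 3 ->
      `|wsum n (nth false w) [seq indic R b | b <- u] 0
          - 'C(n, 3)%:R * \prod_(b <- u) letter_freq d b|
        <= c ^+ 3 * n%:R ^+ 3.
    move=> /eqP size_u; have := counts (Tuple size_u).
    by rewrite occurrencesE letter_freq_prod mulrC.
  pose y (b : bool) : R := b%:R - d.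
  have := @wsum_of_pattern_counts R n (nth false w) (letter_freq d) _ _
    [:: fun=> 1; y; y] [::] counts_seq.
  rewrite !big_cons !big_nil /= /y /=.
  (* The main term vanishes since the mean of y under the frequencies is 0. *)
  rewrite [X in _ - X](_ : _ = 0) ?subr0; last by ring.
  have -> : `|1 - d| = 1 - d by rewrite ger0_norm; lra.
  have -> : `|0 - d| = d by rewrite sub0r normrN ger0_norm; lra.
  rewrite normr1 [X in _ <= X](_ : _ = 2 * (c ^+ 3 * n%:R ^+ 3)); last by ring.
  congr (`|_| <= _); apply: eq_bigr => i _; rewrite mul1r.
  by apply: eq_bigr => j _; congr (_ * _); apply: eq_bigr => k _; rewrite mulr1.
have squares : \sum_(0 <= i < n) T i.+1 ^+ 2 <= 5 * (c * n%:R) ^+ 3.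
  rewrite (eq_bigr _ (fun i _ => sqr_suffix_sum n x i.+1)) big_split -mulr_sumr /=.
  have diag : \sum_(0 <= i < n) \sum_(i.+1 <= j < n) x j ^+ 2 <= n%:R * n%:R.
    have row_le i : \sum_(i.+1 <= j < n) x j ^+ 2 <= n%:R.
      apply: (@le_trans _ _ (\sum_(i.+1 <= j < n) (1 : R))).
        by apply: ler_sum => j _; rewrite -real_normK ?num_real // expr_le1.
      by rewrite sumr_const_nat ler_nat leq_subr.
    apply: le_trans (ler_sum _ (fun i _ => row_le i)) _.
    by rewrite sumr_const_nat subn0 mulr_natr.
  have : (n%:R * n%:R : R) <= (c * n%:R) ^+ 3.
    have -> : (c * n%:R) ^+ 3 = c ^+ 3 * n%:R * (n%:R * n%:R) by ring.
    by rewrite ler_peMl // mulr_ge0.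
  move: pairs; rewrite ler_norml exprMn => /andP[_].
  by move: diag; rewrite -exprMn /T; lra.
(* k <= |T m| / 2 < k + 1 and k^3 <= 5 (c n)^3 < (2 c n)^3 give
   |T m| < 4 c n + 2 <= 6 c n. *)
set k := Num.truncn (`|T m| / 2).
have /truncn_itv : 0 <= `|T m| / 2 by rewrite divr_ge0.
rewrite -/k => /andP[k_le lt_k].
have : (k%:R : R) <= 2 * (c * n%:R).
  rewrite -(@ler_pXn2r _ 3) ?nnegrE //; [|lra].
  rewrite -natrX; apply: le_trans (cube_le_sum_sqr_suffix x_le1 (m := m) _) _.
    by rewrite natrM -/(T m); lra.
  apply: le_trans squares _.
  by rewrite [X in _ <= X]exprMn ler_wpM2r ?exprn_ge0 //; lra.
by move: lt_k; rewrite -[k.+1%:R]natr1 -/(T m); lra.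
Qed.

Theorem theorem1 (R : realType) (eps d : R) (l : nat)
    (heps : 0 < eps) (hd : 0 <= d <= 1) :
  exists n0 : nat, forall n : nat, (n0 < n)%N ->
    (forall w : word n, uniform d eps w ->
       forall u : word l,
         eq_pm (occurrences w u)%:R
           (d ^+ ones u * (1 - d) ^+ (l - ones u) * 'C(n, l)%:R)
           (5 * eps * n%:R ^+ l))
    /\
    (forall w : word n,
       (forall u : word 3,
          eq_pm (occurrences w u)%:R
            (d ^+ ones u * (1 - d) ^+ (3 - ones u) * 'C(n, 3)%:R)
            (eps * n%:R ^+ 3)) ->
       uniform d (42 * eps `^ (3^-1)) w).
Proof.
set c := eps `^ 3^-1.
have c_gt0 : 0 < c by rewrite powR_gt0.
have c3 : c ^+ 3 = eps.
  by rewrite -powR_mulrn ?ltW // -powRrM mulVf ?pnatr_eq0 // powRr1 ?ltW.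
(* Both c n >= 1 and eps n >= 1 are needed: the first absorbs rounding, the second
   the diagonal terms. *)
exists (Num.truncn c^-1 + Num.truncn eps^-1)%N => n lt_n.
have large (y : R) : 0 < y -> (Num.truncn y^-1 < n)%N -> 1 <= y * n%:R.
  move=> y_gt0 lt_yn; rewrite -ler_pdivrMl // mulr1 ltW //.
  have /truncn_itv/andP[_ lt_y] : 0 <= y^-1 by rewrite invr_ge0 ltW.
  by apply: lt_le_trans lt_y _; rewrite ler_nat.
split=> w.
  move=> w_unif u; apply/eq_pmP; rewrite occurrencesE letter_freq_prod.
  have disc_e a b : (a <= b <= n)%N ->
      `|\sum_(a <= i < b) disc d w i| <= eps * n%:R.
    move=> /andP[_ le_bn]; have /eq_pmP := w_unif a b.
    by rewrite interval_disc (minn_idPl le_bn).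
  have := pattern_count_approx u hd disc_e (leq0n n).
  rewrite subn0 size_tuple => /le_trans; apply.
  rewrite -mulrA -natrM [5 * _]mulrC -mulrA ler_pM2l // -natrX -natrM ler_nat.
  by apply: leq_trans (size_mul_bin_le n l) _; rewrite leq_mul2r orbT.
move=> counts a b; apply/eq_pmP; rewrite interval_disc.
have suffix m : `|\sum_(m <= i < n) disc d w i| <= 21 * c * n%:R.
  apply: suffix_disc_bound => //; rewrite ?c3.
  - by apply: large => //; lia.
  - by apply: large => //; lia.
  - by move=> u; apply/eq_pmP; apply: counts.
have cn_ge0 : 0 <= c * n%:R by rewrite mulr_ge0 // ltW.
have [le_ba|lt_ab] := leqP (minn b n) a.
  by rewrite big_geq // normr0; lra.
have := suffix a; have := suffix (minn b n).
rewrite [X in _ -> `|X| <= _ -> _](big_cat_nat (n := minn b n)) ?geq_minr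
  ?(ltnW lt_ab) //=.
set X := \sum_(_ <= _ < minn b n) _; set Y := \sum_(_ <= _ < n) _.
by rewrite !ler_norml; lra.
Qed.
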